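(* Let $X$ be a set of less than measurable cardinality, let $(K_x)_{x\in X}$ be a family of finite dimensional complex Banach spaces, and let $B=\prod_{x\in X}B(K_x)$. Then for any representation $\pi$ of $B$ on a Banach space $K$ there exist a finite subset $Y\subset X$ and a Banach space valued map $\kappa:x\in Y\mapsto K(x)$ such that $\pi$ is equivalent to the representation $$p_\kappa=\bigoplus_{x\in Y}p_x\otimes I_{K(x)}$$ of $B$ on $\bigoplus_{x\in Y}K_x\otimes K(x)$.
   Context: For a complex Banach space $K$, $B(K)$ is the Banach algebra of bounded operators on $K$. $B=\prod_{x\in X}B(K_x)$ is the unrestricted algebraic direct product: all functions $b$ on $X$ with $b(x)\in B(K_x)$ for every $x$ (no boundedness condition), a unital algebra under pointwise operations. A representation of $B$ on a Banach space $K$ is a unital algebra homomorphism $\pi:B\to B(K)$ (no continuity assumed). Two representations are equivalent if there is an invertible (bounded, with bounded inverse) intertwiner between them. $p_x$ denotes the representation of $B$ on $K_x$ obtained by projecting onto the factor $B(K_x)$, i.e. $p_x(b)=b(x)$. $I_{K(x)}$ is the identity operator on $K(x)$. Since $K_x$ is finite dimensional, $K_x\otimes K(x)$ is the algebraic tensor product, isomorphic to a finite direct sum of $\dim K_x$ copies of $K(x)$, with the corresponding Banach space topology. Measurable cardinality: a filter over a set $S$ is a collection of nonempty subsets of $S$ containing $S$ and closed under finite intersections and supersets; it is an ultrafilter if for every $U\subset S$ it contains $U$ or $U^c$; it is principal if it has the form $\{U\subset S: V\subset U\}$ for some $V\subset S$; it is $\lambda$-complete if closed under intersections of fewer than $\lambda$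 of its members. An uncountable set $S$ is of measurable cardinality if there is a nonprincipal $|S|$-complete ultrafilter over $S$. A set has less than measurable cardinality if its cardinality is smaller than the first measurable cardinal (every set qualifies if no measurable cardinal exists). *)

(* Defs.v *)
From HB Require Import structures.
From mathcomp Require Import all_boot all_order all_algebra finmap complex.
From mathcomp Require Import all_classical reals topology normedtype.

Set Implicit Arguments.
Unset Strict Implicit.
Unset Printing Implicit Defensive.

Import Order.TTheory GRing.Theory Num.Theory.
Import numFieldNormedType.Exports.

Local Open Scope classical_set_scope.
Local Open Scope card_scope.
Local Open Scope ring_scope.

Definition card_lt (T U : Type) (A : set T) (B : set U) : Prop :=
  A #<= B /\ ~ (B #<= A).

Definition ultrafilter (S : Type) (F : set_system S) : Prop :=
  ProperFilter F /\ forall U : set S, F U \/ F (~` U).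

Definition principal (S : Type) (F : set_system S) : Prop :=
  exists V : set S, F = [set U | V `<=` U].

Definition card_complete (S : Type) (F : set_system S) : Prop :=
  forall G : set_system S, G `<=` F -> card_lt G [set: S] ->
    F (\bigcap_(U in G) U).

Definition measurable_cardinality (S : Type) : Prop :=
  ~ countable [set: S] /\
  exists F : set_system S,
    [/\ ultrafilter F, ~ principal F & card_complete F].

(* Being below the first measurable cardinal is being below all of them; the
   condition is vacuous when there is none. *)
Definition less_than_measurable (X : Type) : Prop :=
  forall S : Type, measurable_cardinality S -> card_lt [set: X] [set: S].

#[short(type="finDimBanachType")]
HB.structure Definition FinDimBanach (k : numFieldType) :=
  {V of CompleteNormedModule k V & Vector k V}.

Record bounded_op (k : numFieldType) (V W : normedModType k) := BoundedOp {
  bop_fun :> V -> W;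
  bop_linear : linear bop_fun;
  bop_bounded : exists M : k, forall x, `|bop_fun x| <= M * `|x| }.

HB.instance Definition _ (k : numFieldType) (V W : normedModType k)
    (f : bounded_op V W) :=
  GRing.isLinear.Build k V W *:%R f (bop_linear f).

Section BoundedOpModule.
Variables (k : numFieldType) (V W : normedModType k).
Implicit Types f g h : bounded_op V W.

Lemma bop_ext f g : (forall x, f x = g x) -> f = g.
Proof.
case: f g => [f fl fb] [g gl gb] /= /funext fg.
case: _ / fg gl gb => gl gb; congr BoundedOp; exact: Prop_irrelevance.
Qed.

Lemma bop_bound_ge0 f : exists2 M : k, 0 <= M & forall x, `|f x| <= M * `|x|.
Proof.
have [M fM] := bop_bounded f.
have [[x x0]|V0] := pselect (exists x : V, x != 0).
  exists M => //; have := le_trans (normr_ge0 _) (fM x).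
  by rewrite pmulr_lge0 // normr_gt0.
exists 0 => // x; have -> : x = 0.
  by apply/eqP/negP => x0; apply: V0; exists x; exact/negP.
by rewrite linear0 !normr0 mulr0.
Qed.

Definition bop_zero : bounded_op V W.
Proof.
refine (@BoundedOp k V W (fun=> 0) _ _).
  by move=> a x y; rewrite scaler0 addr0.
by exists 0 => x; rewrite normr0 mul0r.
Defined.

Definition bop_opp f : bounded_op V W.
Proof.
refine (@BoundedOp k V W (fun x => - f x) _ _).
  by move=> a x y; rewrite linearP opprD scalerN.
by have [M _ fM] := bop_bound_ge0 f; exists M => x; rewrite normrN.
Defined.

Definition bop_add f g : bounded_op V W.
Proof.
refine (@BoundedOp k V W (fun x => f x + g x) _ _).
  by move=> a x y; rewrite !linearP scalerDr addrACA.
have [M _ fM] := bop_bound_ge0 f; have [N _ gN] := bop_bound_ge0 g.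
by exists (M + N) => x; rewrite mulrDl (le_trans (ler_normD _ _))// lerD.
Defined.

Definition bop_scale (a : k) f : bounded_op V W.
Proof.
refine (@BoundedOp k V W (fun x => a *: f x) _ _).
  by move=> b x y; rewrite linearP scalerDr !scalerA mulrC.
have [M _ fM] := bop_bound_ge0 f; exists (`|a| * M) => x.
by rewrite normrZ -mulrA ler_wpM2l.
Defined.

Lemma bop_addA : associative bop_add.
Proof. by move=> f g h; apply: bop_ext => x /=; rewrite addrA. Qed.
Lemma bop_addC : commutative bop_add.
Proof. by move=> f g; apply: bop_ext => x /=; rewrite addrC. Qed.
Lemma bop_add0 : left_id bop_zero bop_add.
Proof. by move=> f; apply: bop_ext => x /=; rewrite add0r. Qed.
Lemma bop_addN : left_inverse bop_zero bop_opp bop_add.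
Proof. by move=> f; apply: bop_ext => x /=; rewrite addNr. Qed.

HB.instance Definition _ := gen_eqMixin (bounded_op V W).
HB.instance Definition _ := gen_choiceMixin (bounded_op V W).
HB.instance Definition _ := GRing.isZmodule.Build (bounded_op V W)
  bop_addA bop_addC bop_add0 bop_addN.

Lemma bop_scaleA a b f : bop_scale a (bop_scale b f) = bop_scale (a * b) f.
Proof. by apply: bop_ext => x /=; rewrite scalerA. Qed.
Lemma bop_scale1 : left_id 1 bop_scale.
Proof. by move=> f; apply: bop_ext => x /=; rewrite scale1r. Qed.
Lemma bop_scaleDr : right_distributive bop_scale +%R.
Proof. by move=> a f g; apply: bop_ext => x /=; rewrite scalerDr. Qed.
Lemma bop_scaleDl f : {morph bop_scale^~ f : a b / a + b}.
Proof. by move=> a b; apply: bop_ext => x /=; rewrite scalerDl. Qed.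

HB.instance Definition _ := GRing.Zmodule_isLmodule.Build k (bounded_op V W)
  bop_scaleA bop_scale1 bop_scaleDr bop_scaleDl.

End BoundedOpModule.

Section BoundedOpRing.
Variables (k : numFieldType) (V : normedModType k).
Implicit Types f g h : bounded_op V V.

Definition bop_id : bounded_op V V.
Proof.
refine (@BoundedOp k V V id _ _); first by [].
by exists 1 => x; rewrite mul1r.
Defined.

Definition bop_comp f g : bounded_op V V.
Proof.
refine (@BoundedOp k V V (fun x => f (g x)) _ _).
  by move=> a x y; rewrite !linearP.
have [M M0 fM] := bop_bound_ge0 f; have [N _ gN] := bop_bound_ge0 g.
by exists (M * N) => x; rewrite (le_trans (fM _))// -mulrA ler_wpM2l.
Defined.

Lemma bop_compA : associative bop_comp.
Proof. by move=> f g h; exact: bop_ext. Qed.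
Lemma bop_comp1l : left_id bop_id bop_comp.
Proof. by move=> f; exact: bop_ext. Qed.
Lemma bop_comp1r : right_id bop_id bop_comp.
Proof. by move=> f; exact: bop_ext. Qed.
Lemma bop_compDl : left_distributive bop_comp +%R.
Proof. by move=> f g h; exact: bop_ext. Qed.
Lemma bop_compDr : right_distributive bop_comp +%R.
Proof. by move=> f g h; apply: bop_ext => x /=; rewrite raddfD. Qed.

(* Only a possibly zero ring: V may be the zero space. *)
HB.instance Definition _ := GRing.Zmodule_isPzRing.Build (bounded_op V V)
  bop_compA bop_comp1l bop_comp1r bop_compDl bop_compDr.

End BoundedOpRing.

Notation "''B' ( V )" := (bounded_op V V) (at level 8, format "''B' ( V )")
  : type_scope.

Definition op_prod (k : numFieldType) (X : Type) (K : X -> normedModType k) :=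
  forall x, 'B(K x).

Section OpProd.
Variables (k : numFieldType) (X : Type) (K : X -> normedModType k).
Local Notation B := (op_prod K).
Implicit Types b c d : B.

HB.instance Definition _ := gen_eqMixin B.
HB.instance Definition _ := gen_choiceMixin B.

Let add b c : B := fun x => b x + c x.
Let mul b c : B := fun x => b x * c x.
Let opp b : B := fun x => - b x.
Let scale (a : k) b : B := fun x => a *: b x.
Let zero : B := fun=> 0.
Let one : B := fun=> 1.

Let addA : associative add.
Proof. by move=> b c d; apply/functional_extensionality_dep => x; exact: addrA. Qed.
Let addC : commutative add.
Proof. by move=> b c; apply/functional_extensionality_dep => x; exact: addrC. Qed.
Let add0 : left_id zero add.
Proof. by move=> b; apply/functional_extensionality_dep => x; exact: add0r. Qed.
Let addN : left_inverse zero opp add.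
Proof. by move=> b; apply/functional_extensionality_dep => x; exact: addNr. Qed.

HB.instance Definition _ := GRing.isZmodule.Build B addA addC add0 addN.

Let mulA : associative mul.
Proof. by move=> b c d; apply/functional_extensionality_dep => x; exact: mulrA. Qed.
Let mul1l : left_id one mul.
Proof. by move=> b; apply/functional_extensionality_dep => x; exact: mul1r. Qed.
Let mul1r : right_id one mul.
Proof. by move=> b; apply/functional_extensionality_dep => x; exact: mulr1. Qed.
Let mulDl : left_distributive mul +%R.
Proof. by move=> b c d; apply/functional_extensionality_dep => x; exact: mulrDl. Qed.
Let mulDr : right_distributive mul +%R.
Proof. by move=> b c d; apply/functional_extensionality_dep => x; exact: mulrDr. Qed.

HB.instance Definition _ := GRing.Zmodule_isPzRing.Build B
  mulA mul1l mul1r mulDl mulDr.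

Let scaleA a a' b : scale a (scale a' b) = scale (a * a') b.
Proof. by apply/functional_extensionality_dep => x; exact: scalerA. Qed.
Let scale1 : left_id 1 scale.
Proof. by move=> b; apply/functional_extensionality_dep => x; exact: scale1r. Qed.
Let scaleDr : right_distributive scale +%R.
Proof. by move=> a b c; apply/functional_extensionality_dep => x; exact: scalerDr. Qed.
Let scaleDl b : {morph scale^~ b : a a' / a + a'}.
Proof. by move=> a a'; apply/functional_extensionality_dep => x; exact: scalerDl. Qed.

HB.instance Definition _ := GRing.Zmodule_isLmodule.Build k B
  scaleA scale1 scaleDr scaleDl.

End OpProd.

Definition dsum (k : numFieldType) (I : finType) (E : I -> completeNormedModType k) :=
  forall i, E i.

Section DirectSumNormed.
Variables (k : numFieldType) (I : finType) (E : I -> completeNormedModType k).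
Local Notation D := (dsum E).
Implicit Types v w : D.

HB.instance Definition _ := gen_eqMixin D.
HB.instance Definition _ := gen_choiceMixin D.

Let add v w : D := fun i => v i + w i.
Let opp v : D := fun i => - v i.
Let scale (a : k) v : D := fun i => a *: v i.
Let zero : D := fun=> 0.

Let addA : associative add.
Proof. by move=> b c d; apply/functional_extensionality_dep => x; exact: addrA. Qed.
Let addC : commutative add.
Proof. by move=> b c; apply/functional_extensionality_dep => x; exact: addrC. Qed.
Let add0 : left_id zero add.
Proof. by move=> b; apply/functional_extensionality_dep => x; exact: add0r. Qed.
Let addN : left_inverse zero opp add.
Proof. by move=> b; apply/functional_extensionality_dep => x; exact: addNr. Qed.

HB.instance Definition _ := GRing.isZmodule.Build D addA addC add0 addN.

Let scaleA a a' v : scale a (scale a' v) = scale (a * a') v.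
Proof. by apply/functional_extensionality_dep => x; exact: scalerA. Qed.
Let scale1 : left_id 1 scale.
Proof. by move=> b; apply/functional_extensionality_dep => x; exact: scale1r. Qed.
Let scaleDr : right_distributive scale +%R.
Proof. by move=> a b c; apply/functional_extensionality_dep => x; exact: scalerDr. Qed.
Let scaleDl v : {morph scale^~ v : a a' / a + a'}.
Proof. by move=> a a'; apply/functional_extensionality_dep => x; exact: scalerDl. Qed.

HB.instance Definition _ := GRing.Zmodule_isLmodule.Build k D
  scaleA scale1 scaleDr scaleDl.

(* Any choice of norm inducing the product topology gives the same space up to
   bounded isomorphism; the l1 norm is the convenient one. *)
Let norm v : k := \sum_i `|v i|.

Let normD v w : norm (v + w) <= norm v + norm w.
Proof.
by rewrite /norm -big_split; apply: ler_sum => i _; exact: ler_normD.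
Qed.
Let normZ a v : norm (a *: v) = `|a| * norm v.
Proof. by rewrite /norm mulr_sumr; apply: eq_bigr => i _; exact: normrZ. Qed.
Let norm_eq0 v : norm v = 0 -> v = 0.
Proof.
move=> /eqP; rewrite psumr_eq0// => /allP v0.
apply/functional_extensionality_dep => i; apply/eqP.
by rewrite -normr_eq0; exact: (v0 i (mem_index_enum _)).
Qed.

HB.instance Definition _ := Lmodule_isNormed.Build k D normD normZ norm_eq0.

Lemma dsum_normE v : `|v| = \sum_i `|v i|. Proof. by []. Qed.

End DirectSumNormed.

Section DirectSumComplete.
Variables (k : numFieldType) (I : finType) (E : I -> completeNormedModType k).
Local Notation D := (dsum E).

Lemma dsum_norm_ge (v : D) i : `|v i| <= `|v|.
Proof. by rewrite dsum_normE (bigD1 i)//= lerDl sumr_ge0. Qed.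

Lemma dsum_complete (F : set_system D) : ProperFilter F -> cauchy F -> cvg F.
Proof.
move=> FF /cauchyP Fc.
have cvgi i : cvg ((fun w : D => w i) @ F).
  apply: cauchy_cvg; apply/cauchyP => e e0; have [x Fx] := Fc e e0.
  exists (x i); suff : F ((fun w : D => w i) @^-1` ball (x i) e) by [].
  apply: filterS Fx => w /=.
  rewrite -!ball_normE/=; apply: le_lt_trans.
  exact: (dsum_norm_ge (x - w)).
pose l : D := fun i => lim ((fun w : D => w i) @ F).
apply/cvg_ex; exists l; apply/(@cvgrPdist_lt _ _ _ F FF id) => e e0.
have n0 : 0 < (#|I|.+1)%:R :> k by rewrite ltr0n.
have d0 : 0 < e / (#|I|.+1)%:R by rewrite divr_gt0.
have nearF : \forall w \near F, forall i, `|l i - w i| < e / (#|I|.+1)%:R.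
  by apply: filter_forall => i; have /cvgrPdist_lt/(_ _ d0) := cvgi i.
apply: filterS nearF => w lw; rewrite dsum_normE.
apply: (@le_lt_trans _ _ (\sum_(i : I) e / (#|I|.+1)%:R)).
  by apply: ler_sum => i _; exact/ltW/lw.
rewrite sumr_const -[X in X < _]mulr_natr mulrAC ltr_pdivrMr//.
by rewrite ltr_pM2l// ltr_nat.
Qed.

HB.instance Definition _ := Uniform_isComplete.Build D dsum_complete.

Lemma dsum_sumE (J : Type) (r : seq J) (P : pred J) (f : J -> D) i :
  (\sum_(j <- r | P j) f j) i = \sum_(j <- r | P j) f j i.
Proof. by elim/big_rec2 : _ => // j _ y _ <-. Qed.

Definition dsum_op (f : forall i, 'B(E i)) : 'B(D).
Proof.
refine (@BoundedOp k D D (fun v i => f i (v i)) _ _).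
  move=> a v w; apply/functional_extensionality_dep => i; exact: linearP.
pose M i := s2val (cid2 (bop_bound_ge0 (f i))).
have M0 i : 0 <= M i by rewrite /M; case: cid2.
have fM i x : `|f i x| <= M i * `|x| by rewrite /M; case: cid2.
exists (\sum_i M i) => v; rewrite !dsum_normE mulr_sumr ler_sum// => i _.
rewrite (le_trans (fM i _))// ler_wpM2r// (bigD1 i)//= lerDl.
by rewrite sumr_ge0.
Defined.

End DirectSumComplete.

(* Coordinates with respect to a basis e of U: the family v stands for
   sum_i e_i (x) v_i. The lemmas tensor_universal and tensor_opE identify the
   result with the algebraic tensor product and with a (x) id. *)
Definition tensor (k : numFieldType) (U : finDimBanachType k)
    (V : completeNormedModType k) : completeNormedModType k :=
  dsum (fun _ : 'I_(\dim {:U}) => V).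

Section LinearSum.
Variables (k : numFieldType) (U W : lmodType k) (f : U -> W).
Hypothesis fl : linear f.

Lemma linear_scale a u : f (a *: u) = a *: f u.
Proof.
have f0 : f 0 = 0.
  by have := fl (-1) 0 0; rewrite !scaleN1r oppr0 addr0 addNr.
by have := fl a u 0; rewrite !addr0 f0 addr0.
Qed.

Lemma linear_sumZ (I : finType) (c : I -> k) (u : I -> U) :
  f (\sum_i c i *: u i) = \sum_i c i *: f (u i).
Proof.
elim/big_rec2 : _ => [|i y x _ <-]; last exact: fl.
by have := linear_scale 0 0; rewrite !scale0r.
Qed.

End LinearSum.

Section Tensor.
Variables (k : numFieldType) (U : finDimBanachType k).
Variable V : completeNormedModType k.
Local Notation e := (vbasis {:U}).

Definition tens (u : U) (v : V) : tensor U V := fun i => coord e i u *: v.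

Lemma tens_linearl v : linear (tens^~ v).
Proof.
move=> a u u'; apply/functional_extensionality_dep => i.
by rewrite /tens linearP scalerDl -scalerA.
Qed.

Lemma tens_linearr u : linear (tens u).
Proof.
move=> a v v'; apply/functional_extensionality_dep => i.
by rewrite /tens scalerDr scalerA mulrC -scalerA.
Qed.

Lemma tens_basisE (w : tensor U V) : w = \sum_(i < \dim {:U}) tens e`_i (w i).
Proof.
apply/functional_extensionality_dep => i; rewrite dsum_sumE (bigD1 i)//=.
rewrite big1 => [|j ji].
  by rewrite /tens coord_free ?eqxx ?scale1r ?addr0// (basis_free (vbasisP _)).
rewrite /tens coord_free ?(basis_free (vbasisP _))//.
rewrite -[(_ == _)]/(val j == val i) val_eqE.
by rewrite (negPf ji) scale0r.
Qed.

Lemma tensor_universal (W : lmodType k) (f : U -> V -> W) :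
  (forall v, linear (f^~ v)) -> (forall u, linear (f u)) ->
  exists g : {linear tensor U V -> W}, (forall u v, g (tens u v) = f u v) /\
    forall h : {linear tensor U V -> W},
      (forall u v, h (tens u v) = f u v) -> h =1 g.
Proof.
move=> fl fr.
pose g0 (w : tensor U V) := \sum_(i < \dim {:U}) f e`_i (w i).
have gl : linear g0.
  move=> a w w'; rewrite /g0 scaler_sumr -big_split/=.
  by apply: eq_bigr => i _; exact: fr.
pose g : {linear tensor U V -> W} :=
  HB.pack g0 (GRing.isLinear.Build k (tensor U V) W *:%R g0 gl).
exists g; split=> [u v|h hf w].
  rewrite [in RHS](coord_vbasis (memvf u)) (linear_sumZ (fl v)).
  apply: eq_bigr => i _; exact: (linear_scale (fr _)).
by rewrite [in LHS](tens_basisE w) linear_sum; apply: eq_bigr => i _; exact: hf.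
Qed.

Lemma tens_norm u v : `|tens u v| = (\sum_i `|coord e i u|) * `|v|.
Proof.
by rewrite dsum_normE mulr_suml; apply: eq_bigr => i _; exact: normrZ.
Qed.

Definition tensor_op (a : 'B(U)) : 'B(tensor U V).
Proof.
refine (@BoundedOp k (tensor U V) (tensor U V)
  (fun w => \sum_(i < \dim {:U}) tens (a e`_i) (w i)) _ _).
  move=> c w w'; rewrite scaler_sumr -big_split/=; apply: eq_bigr => i _.
  exact: tens_linearr.
exists (\sum_(j < \dim {:U}) \sum_i `|coord e i (a e`_j)|) => w.
rewrite (le_trans (ler_norm_sum _ _ _))// dsum_normE mulr_sumr ler_sum// => j _.
rewrite tens_norm ler_wpM2r// [leRHS](bigD1 j)//= lerDl sumr_ge0// => i _.
by rewrite sumr_ge0.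
Defined.

Lemma tensor_opE (a : 'B(U)) u v : tensor_op a (tens u v) = tens (a u) v.
Proof.
rewrite [in RHS](coord_vbasis (memvf u)) linear_sum.
under [in RHS]eq_bigr do rewrite linearZ.
rewrite (linear_sumZ (tens_linearl v)).
by apply: eq_bigr => i _; exact: (linear_scale (tens_linearr _)).
Qed.

Lemma tensor_op_linear : linear tensor_op.
Proof.
move=> c a a'; apply: bop_ext => w /=; rewrite scaler_sumr -big_split/=.
by apply: eq_bigr => i _; exact: tens_linearl.
Qed.

Lemma tensor_op_morph : GRing.monoid_morphism tensor_op.
Proof.
split=> [|a b]; apply: bop_ext => w; first exact/esym/tens_basisE.
rewrite -[RHS]/(tensor_op a (tensor_op b w)) [tensor_op b w]/=.
rewrite [RHS]linear_sum; apply: eq_bigr => i _.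
exact/esym/tensor_opE.
Qed.

End Tensor.

Record representation (k : numFieldType) (X : Type) (K : X -> finDimBanachType k)
    (E : completeNormedModType k) := Representation {
  rep_fun :> {linear op_prod K -> 'B(E)};
  rep_morph : GRing.monoid_morphism rep_fun }.

Definition rep_equivalent (k : numFieldType) (X : Type)
    (K : X -> finDimBanachType k) (E F : completeNormedModType k)
    (pi : representation K E) (rho : representation K F) : Prop :=
  exists (T : bounded_op E F) (S : bounded_op F E),
    [/\ cancel T S, cancel S T & forall b v, T (pi b v) = rho b (T v)].

Section Representations.
Variables (k : numFieldType) (X : Type) (K : X -> finDimBanachType k).
Implicit Types (E V : completeNormedModType k) (U : finDimBanachType k).

Definition mk_rep E (f : op_prod K -> 'B(E)) (fl : linear f)
    (fm : GRing.monoid_morphism f) : representation K E :=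
  @Representation k X K E
    (HB.pack f (GRing.isLinear.Build k (op_prod K) 'B(E) *:%R f fl)) fm.

Definition proj_rep (x : X) : representation K (K x) :=
  @mk_rep (K x) (fun b => b x) (fun _ _ _ => erefl)
    (conj erefl (fun _ _ => erefl)).

Fact tensor_rep_linear U V (pi : representation K U) :
  linear (fun b => tensor_op V (pi b)).
Proof. by move=> a b c; rewrite linearP tensor_op_linear. Qed.

Fact tensor_rep_morph U V (pi : representation K U) :
  GRing.monoid_morphism (fun b => tensor_op V (pi b)).
Proof.
have [t1 tM] := tensor_op_morph U V; have [p1 pM] := rep_morph pi.
by split=> [|b c]; rewrite ?p1 ?pM.
Qed.

Definition tensor_rep U V (pi : representation K U) :
    representation K (tensor U V) :=
  mk_rep (tensor_rep_linear V pi) (tensor_rep_morph V pi).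

Fact dsum_rep_linear (I : finType) (E : I -> completeNormedModType k)
    (pi : forall i, representation K (E i)) :
  linear (fun b => dsum_op (fun i => pi i b)).
Proof.
move=> a b c; apply: bop_ext => v; apply/functional_extensionality_dep => i.
by rewrite /= linearP.
Qed.

Fact dsum_rep_morph (I : finType) (E : I -> completeNormedModType k)
    (pi : forall i, representation K (E i)) :
  GRing.monoid_morphism (fun b => dsum_op (fun i => pi i b)).
Proof.
split=> [|b c]; apply: bop_ext => v; apply/functional_extensionality_dep => i /=.
  by have [-> _] := rep_morph (pi i).
by have [_ ->] := rep_morph (pi i).
Qed.

Definition dsum_rep (I : finType) (E : I -> completeNormedModType k)
    (pi : forall i, representation K (E i)) : representation K (dsum E) :=
  mk_rep (dsum_rep_linear pi) (dsum_rep_morph pi).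

End Representations.

Definition p_kappa (k : numFieldType) (X : choiceType)
    (K : X -> finDimBanachType k) (Y : {fset X})
    (kappa : Y -> completeNormedModType k) :
    representation K (dsum (fun y : Y => tensor (K (val y)) (kappa y))) :=
  dsum_rep (fun y : Y => tensor_rep (kappa y) (proj_rep K (val y))).

(* Main.v *)
Require Import Defs.
From HB Require Import structures.
From mathcomp Require Import all_boot all_order all_algebra finmap complex.
From mathcomp Require Import all_classical reals topology normedtype derive.
From mathcomp Require Import ring lra.

Set Implicit Arguments.
Unset Strict Implicit.
Unset Printing Implicit Defensive.

Import Order.TTheory GRing.Theory Num.Theory.
Import numFieldNormedType.Exports.

Local Open Scope classical_set_scope.
Local Open Scope card_scope.
Local Open Scope ring_scope.

(** Call a set A of indices null when pi kills the idempotent of the product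
    that is 1 on A and 0 elsewhere. Everything rests on the fact that the null
    sets are nearly everything: only finitely many singletons fail to be null,
    and the indices whose singletons are null form together a null set
    ([null_cofinite]).

    The null sets form an ideal with two strong properties. Among infinitely
    many disjoint sets one is null ([null_ccc]): the product contains the
    unbounded function equal to n on the n-th set, and if no set were null its
    image would have every n as an eigenvalue, although it is a bounded
    operator. And the ideal is countably complete ([null_sigma]): if every
    fibre of u : X -> nat were null in A while A is not, then u - z would be
    invertible modulo null sets for every complex z, so that the bounded
    operator pi(u) would have an everywhere defined resolvent on a nonzero
    vector, which is impossible because the spectrum is nonempty
    ([no_entire_resolvent]). Both arguments rest on the boundedness of the
    individual operators pi(b), not on any continuity of pi itself.

    By the first property a set that is not null contains an atom of the ideal,
    hence carries an ultrafilter, countably complete by the second. If all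
    singletons of that set were null, the ultrafilter would not be principal,
    and pushing it forward to a set of least cardinality onto which it can be
    mapped with null fibres makes that set of measurable cardinality
    ([measurable_of_ultrafilter]), which is excluded below the first measurable
    cardinal.

    So pi factors through a finite product of full matrix algebras, and the
    classical description of the modules over matrix algebras applies: with
    matrix units e_ij in the factor B(K_x), the space K(x) is the range of the
    idempotent pi(e_00), and v is sent to the family of the pi(e_0i) v. The
    matrix units lie in B(K_x) because linear functionals on a finite
    dimensional normed space are bounded ([coord_bounded]). *)

(** * Countably complete ideals below the first measurable cardinal *)

(** Cardinals are well-founded, in the form needed here. A maximal set of
    choice functions that is injective in every coordinate must exhaust one
    coordinate, for otherwise a new function could be added; the exhausted
    member of the family then injects into all the others. *)
Lemma min_card_ex (X : Type) (P : set (set X)) : P !=set0 ->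
  exists2 S, P S & forall S', P S' -> S #<= S'.
Proof.
move=> [S0 PS0]; pose I := {S | P S}.
pose i0 : I := exist _ S0 PS0.
pose trans (A : set (I -> X)) := (forall g i, A g -> sval i (g i)) /\
  forall g h i, A g -> A h -> g i = h i -> g = h.
have [|A [[AS Ainj] Amax]] := @Zorn_bigcup (I -> X) trans.
  move=> F Ftrans Ftot; split=> [g i [A FA Ag]|g h i [A FA Ag] [B FB Bh]].
    exact: (Ftrans A FA).1.
  have [AB|BA] := Ftot _ _ FA FB.
    by apply: (Ftrans B FB).2 => //; exact: AB.
  by apply: (Ftrans A FA).2 => //; exact: BA.
have [[i Ai]|noi] := pselect (exists i : I, sval i `<=` (fun g => g i) @` A).
  exists (sval i) => [|S' PS']; first exact: svalP i.
  pose j : I := exist _ S' PS'.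
  have -> : sval i = (fun g => g i) @` A.
    by apply/seteqP; split=> // _ [g Ag <-]; exact: AS.
  apply: card_le_trans (card_image_le _ _) _.
  have /card_eqPle[_ Aj] : (fun g : I -> X => g j) @` A #= A.
    by apply: inj_card_eq => g h /set_mem Ag /set_mem Ah; exact: Ainj.
  apply: card_le_trans Aj _; apply: subset_card_le => _ [g Ag <-].
  exact: (AS g j Ag).
have new i : exists x, sval i x /\ forall g, A g -> g i <> x.
  apply: contrapT => nx; apply: noi; exists i => x Six; apply: contrapT => Ax.
  by apply: nx; exists x; split=> // g Ag gx; apply: Ax; exists g.
have [g gP] := choice new.
exfalso; apply: (Amax (A `|` [set g])).
  split; first by left.
  by move=> /(_ g (or_intror erefl)) Ag; exact: ((gP i0).2 g Ag).
split=> [h i [Ah|->]|h h' i [Ah|->] [Ah'|->]] //.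
- exact: AS.
- exact: (gP i).1.
- exact: Ainj.
- by move=> hg; case: ((gP i).2 h Ah).
- by move=> /esym hg; case: ((gP i).2 h' Ah').
Qed.

Lemma card_sig_le (X : Type) (S : set X) : [set: {x | S x}] #<= S.
Proof.
have /card_eqPle[_ h] : (@sval X S) @` [set: {x | S x}] #= [set: {x | S x}].
  by apply: inj_card_eq => -[a Sa] [b Sb] _ _ /= ab; exact: eq_exist.
by apply: card_le_trans h _; apply: subset_card_le => _ [[y Sy] _ <-].
Qed.

Lemma ultrafilterN S (F : set_system S) (A : set S) :
  ultrafilter F -> F (~` A) <-> ~ F A.
Proof.
move=> [FF FU]; split=> [FnA FA|nFA]; last by have [|] := FU A.
by have [x []] := @filter_ex _ F _ _ (filterI FA FnA).
Qed.

Lemma ultrafilter_preim X T (F : set_system X) (f : X -> T) :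
  ultrafilter F -> ultrafilter [set U | F (f @^-1` U)].
Proof.
move=> [FF FU]; split=> [|U]; last exact: FU.
split; last first.
  split=> [|A B /= FA FB|A B AB]; first exact: filterT.
  - exact: filterI FA FB.
  - by apply: filterS => x; exact: AB.
by move=> /filter_ex[].
Qed.

(** Let S be of least cardinality among the sets to which X maps with
    fibres outside F. The image of F on S is then complete for families G of
    fewer than |S| sets: if the intersection of G were small, sending a point to
    some member of G that misses it would map S, hence X, to the smaller set G,
    again with small fibres. Countable completeness of F makes S uncountable. *)
Lemma measurable_of_ultrafilter (X : Type) (F : set_system X) :
  ultrafilter F -> (forall x, ~ F [set x]) ->
  (forall u : X -> nat, exists n, F (u @^-1` [set n])) ->
  exists S : set X, measurable_cardinality {x | S x}.
Proof.
move=> uF F1 Fsig; have [FF FU] := uF.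
pose P (S : set X) := exists f : X -> X,
  (forall x, S (f x)) /\ forall s, ~ F (f @^-1` [set s]).
have [|S [f [Sf f1]] Smin] := @min_card_ex X P.
  by exists setT, id; split=> // x; exact: F1.
exists S; pose T := {x | S x}.
pose f' x : T := exist _ (f x) (Sf x).
pose F' := [set U : set T | F (f' @^-1` U)].
have uF' : ultrafilter F' by exact: ultrafilter_preim.
have F'1 t : ~ F' [set t].
  move=> F't; apply: (f1 (sval t)).
  by apply: (@filterS _ F _ (f' @^-1` [set t])) => // x <-.
have [FF' _] := uF'.
split.
  move=> /countable_injP[g ginj].
  have [n Fn] := Fsig (g \o f').
  have [x xn] := filter_ex Fn.
  apply: (F'1 (f' x)).
  apply: (@filterS _ F _ ((g \o f') @^-1` [set n])) => // y yn.
  by apply: ginj; rewrite ?inE//; rewrite /= in xn yn; rewrite xn yn.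
exists F'; split => //.
  move=> [V F'V].
  have VV : F' V by rewrite F'V.
  have [t Vt] := filter_ex VV.
  have : F' (~` [set t]) by apply/ultrafilterN.
  by rewrite F'V => /(_ _ Vt); apply.
move=> G GF' [GT TG]; apply: contrapT => nG.
have Gn : F' (~` \bigcap_(U in G) U) by apply/ultrafilterN.
have [t0 _] := filter_ex Gn.
pose T' : pointedType := HB.pack T (gen_eqMixin T)
  (gen_choiceMixin T) (isPointed.Build T t0).
have [k kinj] : exists k : set T -> T', {in G &, injective k} by exact/pcard_injP.
have [U0 GU0] : exists U0, G U0.
  apply: contrapT => G0; apply: nG.
  by apply: (filterS _ (@filterT _ F' _)) => t _ U GU; case: G0; exists U.
(* The members of the intersection have nowhere to go; as they form a small
   set, they may all be sent to U0. *)
have hex (t : T) : exists U, G U /\ ((~` \bigcap_(U in G) U) t -> ~ U t).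
  have [Gt|] := pselect ((\bigcap_(U in G) U) t); first by exists U0.
  by move=> /existsNP[U /not_implyP[GU Ut]]; exists U.
have [h hP] := choice hex.
pose k' (U : set T) : X := sval (k U : T).
have PS' : P (k' @` G).
  exists (fun x => k' (h (f' x))); split=> [x|s Fs].
    by exists (h (f' x)) => //; exact: (hP _).1.
  have F's : F' ((fun t => k' (h t)) @^-1` [set s]) by [].
  have FsG := @filterI _ F' (@filter_filter _ F' FF') _ _ F's Gn.
  have [t1 [t1s t1G]] := filter_ex FsG.
  have FU1 := GF' _ (hP t1).1.
  have [t [[ts tG] tU]] :=
    filter_ex (@filterI _ F' (@filter_filter _ F' FF') _ _ FsG FU1).
  apply: ((hP t).2 tG); suff -> : h t = h t1 by exact: tU.
  apply: kinj; rewrite ?inE; [exact: (hP _).1|exact: (hP _).1|].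
  move: ts t1s => /= <- /esym; rewrite /k'.
  case: (k (h t)) => a Sa; case: (k (h t1)) => b Sb /= ab.
  exact: eq_exist.
apply: TG; apply: card_le_trans (card_sig_le S) _.
exact: card_le_trans (Smin _ PS') (card_image_le _ _).
Qed.

Lemma not_measurable_sub (X : Type) (S : set X) :
  less_than_measurable X -> ~ measurable_cardinality {x | S x}.
Proof.
by move=> lX /lX[_]; apply; apply: card_le_trans (card_sig_le S) (card_leT S).
Qed.

Section SigmaIdeal.
Variables (X : Type) (N : set X -> Prop).
Hypothesis N0 : N set0.
Hypothesis NS : forall A B, A `<=` B -> N B -> N A.
Hypothesis NU : forall A B, N A -> N B -> N (A `|` B).
Hypothesis Nccc : forall A : nat -> set X, trivIset setT A -> exists n, N (A n).
Hypothesis Nsigma : forall A (u : X -> nat),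
  (forall n, N (A `&` u @^-1` [set n])) -> N A.

(** If every subset of Z outside N could be split into two sets outside N,
    splitting forever and keeping one half at each step would leave infinitely
    many disjoint sets outside N. *)
Lemma atom_ex (Z : set X) : ~ N Z ->
  exists A, [/\ A `<=` Z, ~ N A & forall B, N (A `&` B) \/ N (A `\` B)].
Proof.
move=> NZ; apply: contrapT => noatom.
pose D := {A | A `<=` Z /\ ~ N A}.
have split (A : D) : exists B : D, sval B `<=` sval A /\ ~ N (sval A `\` sval B).
  case: A => A [AZ NA]; apply: contrapT => nB; apply: noatom; exists A.
  split=> // B; have [|NAB] := pselect (N (A `&` B)); [by left|right].
  apply: contrapT => NAB'; apply: nB.
  have AB : A `&` B `<=` Z /\ ~ N (A `&` B) by split=> // x [/AZ].
  exists (exist (fun A => A `<=` Z /\ ~ N A) _ AB); split=> /=; first by move=> x [].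
  by rewrite setDIr setDv set0U.
have [s sP] := choice split.
pose D0 : D :=
  exist (fun A => A `<=` Z /\ ~ N A) Z (conj (@subset_refl _ Z) NZ).
pose d n : set X := sval (iter n s D0).
have dS m n : (m <= n)%N -> d n `<=` d m.
  move=> /subnK <-; elim: (n - m)%N => [|i IH]//; rewrite addSn.
  by apply: subset_trans IH; exact: (sP _).1.
have [|n] := Nccc (A := fun n => d n `\` d n.+1); last exact: (sP _).2.
move=> m n _ _ [x [[dm dm1] [dn dn1]]].
have [mn|nm|//] := ltngtP m n.
- by case: dm1; exact: dS mn _ dn.
- by case: dn1; exact: dS nm _ dm.
Qed.

(** The sets containing an atom A up to N form an ultrafilter. If A consisted
    of points whose singletons lie in N, this ultrafilter would contain no
    singleton, and some subset of X would have measurable cardinality. *)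
Lemma sigma_ideal_finite : less_than_measurable X ->
  finite_set [set x | ~ N [set x]] /\ N [set x | N [set x]].
Proof.
move=> lX; split.
  apply: contrapT => /infiniteP/card_leP[f].
  pose g n : X := val (f (SigSub (mem_set (I : [set: nat] n)))).
  have [|n] := Nccc (A := fun n => [set g n]).
    by move=> m n _ _ [x [-> /val_inj/inj/(congr1 val)]]; apply; rewrite inE.
  exact: (set_mem (valP (f (SigSub (mem_set (I : [set: nat] n)))))).
apply: contrapT => /atom_ex[A [AZ NA Aat]].
pose F := [set U | N (A `\` U)].
have Fn U : F U -> N (A `&` U) -> False.
  by move=> FU NU'; apply: NA; rewrite -(setUIDK A U); exact: NU.
have uF : ultrafilter F.
  split; last first.
    move=> U; have [NU'|] := Aat U; [right|by left].
    by rewrite /F/= setDE setCK.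
  split=> [/Fn|]; first by rewrite setI0; apply.
  split=> [|U V FU FV|U V UV FU]; rewrite /F/=.
  - by rewrite setDT.
  - by rewrite setDIr; exact: NU.
  - by apply: NS FU => x [Ax Vx]; split=> // /UV.
have [||S] := @measurable_of_ultrafilter X F uF; last exact: not_measurable_sub.
  move=> x Fx; apply: (Fn _ Fx); have [Ax|Ax] := pselect (A x).
    by apply: NS (AZ _ Ax) => y [].
  by apply: NS N0 => y [Ay yx]; apply: Ax; rewrite -yx.
move=> u; apply: contrapT => /forallNP nu; apply: NA; apply: (@Nsigma _ u) => n.
by have [//|/nu] := Aat (u @^-1` [set n]).
Qed.

End SigmaIdeal.

(** * Nonemptiness of the local spectrum *)

Section RealNorm.
Local Open Scope complex_scope.
Local Open Scope ring_scope.
Variable R : realType.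
Implicit Types V W : normedModType R[i].

(** The norm of a complex normed space takes its values in R[i]; real-valued
    norms are needed for the extreme value theorem and for real arithmetic. *)
Definition rnorm V (v : V) : R := complex.Re `|v|.

Lemma rnormE V (v : V) : `|v| = (rnorm v)%:C.
Proof. by rewrite /rnorm RRe_real// normr_real. Qed.

Lemma rnorm_ge0 V (v : V) : 0 <= rnorm v.
Proof. by rewrite -ler0c -rnormE. Qed.

Lemma rnorm_eq0 V (v : V) : (rnorm v == 0) = (v == 0).
Proof. by rewrite -(normr_eq0 v) rnormE -(inj_eq (@complexI R)). Qed.

Lemma rnormD V (v w : V) : rnorm (v + w) <= rnorm v + rnorm w.
Proof. by rewrite -lecR rmorphD/= -!rnormE ler_normD. Qed.

Lemma rnormN V (v : V) : rnorm (- v) = rnorm v.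
Proof. by rewrite /rnorm normrN. Qed.

Lemma rnormB V (v w : V) : rnorm (v - w) <= rnorm v + rnorm w.
Proof. by rewrite -(rnormN w) rnormD. Qed.

Lemma rnormZ V (a : R[i]) (v : V) : rnorm (a *: v) = complex.Re `|a| * rnorm v.
Proof.
by apply: (@complexI R); rewrite rmorphM/= -!rnormE normrZ.
Qed.

Lemma rnormZ_real V (a : R) (v : V) : rnorm (a%:C *: v) = `|a| * rnorm v.
Proof. by rewrite rnormZ normc_def/= expr0n addr0 sqrtr_sqr. Qed.

Lemma rnorm_sum V (I : finType) (v : I -> V) :
  rnorm (\sum_i v i) <= \sum_i rnorm (v i).
Proof.
elim/big_ind2 : _ => // [|a b c d ab cd].
  by rewrite le_eqVlt rnorm_eq0 eqxx.
by rewrite (le_trans (rnormD _ _))// lerD.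
Qed.

Lemma bop_rbound V W (f : bounded_op V W) :
  exists2 M : R, 0 <= M & forall v, rnorm (f v) <= M * rnorm v.
Proof.
have [M M0 fM] := bop_bound_ge0 f.
have MR : (complex.Re M)%:C = M by rewrite RRe_real// ger0_real.
exists (complex.Re M); first by rewrite -ler0c MR.
by move=> v; rewrite -lecR rmorphM/= MR -!rnormE.
Qed.

Lemma cabs_le (a b : R) : complex.Re `|a +i* b| <= `|a| + `|b|.
Proof.
rewrite normc_def/= -[leRHS]ger0_norm ?addr_ge0// -sqrtr_sqr ler_wsqrtr//.
rewrite sqrrD !real_normK ?num_real// -subr_ge0.
have -> : a ^+ 2 + (`|a| * `|b|) *+ 2 + b ^+ 2 - (a ^+ 2 + b ^+ 2) =
  (`|a| * `|b|) *+ 2 by ring.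
by rewrite mulrn_wge0// mulr_ge0.
Qed.

Lemma cabs_ge (a b : R) : `|a| <= complex.Re `|a +i* b| /\
  `|b| <= complex.Re `|a +i* b|.
Proof.
by rewrite normc_def/= -!sqrtr_sqr !ler_wsqrtr// ?lerDl ?lerDr ?sqr_ge0.
Qed.

End RealNorm.

Section LocalSpectrum.
Local Open Scope complex_scope.
Local Open Scope ring_scope.
Variables (R : realType) (E : normedModType R[i]).
Variables (G : R[i] -> 'B(E)) (y : R[i] -> E).
(* In the application G z = (U - z)^-1 and y z = G z v, so that this is the
   resolvent identity applied to v. *)
Hypothesis resolvent : forall z w, y w = y z + (w - z) *: G z (y w).

Lemma resolvent4 z s : y (z + s) = \sum_(k < 4) s ^+ k *: iter k (G z) (y z) +
  s ^+ 4 *: iter 4 (G z) (y (z + s)).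
Proof.
have q : y (z + s) = y z + s *: G z (y (z + s)).
  by rewrite [LHS](resolvent z) [z + s - z]addrC addKr.
have iterZ a (k : nat) v : iter k (G z) (a *: v) = a *: iter k (G z) v.
  by elim: k => //= k ->; rewrite linearZ.
have iterD (k : nat) v w : iter k (G z) (v + w) = iter k (G z) v + iter k (G z) w.
  by elim: k => //= k ->; rewrite linearD.
suff: forall n, y (z + s) = \sum_(k < n) s ^+ k *: iter k (G z) (y z) +
    s ^+ n *: iter n (G z) (y (z + s)) by exact.
elim=> [|n IH]; first by rewrite big_ord0 add0r expr0 scale1r.
rewrite [LHS]IH big_ord_recr/= -addrA; congr (_ + _).
by rewrite [in LHS]q iterD iterZ -iterSr scalerDr scalerA -exprSr.
Qed.

(** A discrete mean value property: averaging the Taylor expansion of y over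
    z + r, z + ir, z - r, z - ir kills the terms of degree 1, 2 and 3, since the
    power sums of the fourth roots of unity vanish. The error is of order r^4,
    which a perturbation of order r^2 will dominate; this is what makes four
    points enough. *)
Lemma four_points z (r : R) :
  \sum_(j < 4) y (z + r%:C * 'i%C ^+ j) = 4%:R *: y z +
  (r ^+ 4)%:C *: iter 4 (G z) (\sum_(j < 4) y (z + r%:C * 'i%C ^+ j)).
Proof.
pose s (j : 'I_4) := r%:C * 'i%C ^+ j : R[i].
have i2 : ('i%C : R[i]) ^+ 2 = -1 by exact: sqr_i.
have i4 : ('i%C : R[i]) ^+ 4 = 1 by rewrite (exprM _ 2 2) i2 sqrrN expr1n.
have s4 j : s j ^+ 4 = (r ^+ 4)%:C.
  by rewrite /s exprMn exprAC i4 expr1n mulr1 rmorphXn.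
(* The power sums of r, ir, -r, -ir; the vanishing ones have the factor
   i^2 + 1. *)
have s0 (k : 'I_4) : \sum_j s j ^+ k = if k == 0%N :> nat then 4%:R else 0.
  rewrite /s; case: k => -[|[|[|[|]]]]//= _.
  - by rewrite sumr_const card_ord.
  - rewrite !big_ord_recl big_ord0/= /bump/= !addn0 !add1n.
    transitivity (r%:C * (1 + 'i%C) * ('i%C ^+ 2 + 1)); first by ring.
    by rewrite i2; ring.
  - rewrite !big_ord_recl big_ord0/= /bump/= !addn0 !add1n.
    transitivity (r%:C ^+ 2 * (1 + 'i%C ^+ 4) * ('i%C ^+ 2 + 1)); first by ring.
    by rewrite i2; ring.
  - rewrite !big_ord_recl big_ord0/= /bump/= !addn0 !add1n.
    transitivity (r%:C ^+ 3 * (1 + 'i%C ^+ 3) * (1 - 'i%C ^+ 2 + 'i%C ^+ 4) *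
      ('i%C ^+ 2 + 1)); first by ring.
    by rewrite i2; ring.
have iter_sum n (f : 'I_4 -> E) :
    iter n (G z) (\sum_j f j) = \sum_j iter n (G z) (f j).
  by elim: n => // n /= ->; rewrite linear_sum.
rewrite [LHS](eq_bigr _ (fun j _ => resolvent4 z (s j))) big_split.
rewrite iter_sum scaler_sumr; congr (_ + _); last first.
  by apply: eq_bigr => j _; rewrite s4.
rewrite exchange_big; under eq_bigr do rewrite -scaler_suml s0.
by rewrite big_ord_recl/= big1 ?addr0// => i _; rewrite scale0r.
Qed.

(** The norm of y is subharmonic up to an error of order r^4. *)
Lemma rnorm_mean z : exists2 M : R, 0 <= M & forall r : R,
  4%:R * rnorm (y z) <=
  (1 + r ^+ 4 * M) * \sum_(j < 4) rnorm (y (z + r%:C * 'i%C ^+ j)).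
Proof.
have [M M0 GM] := bop_rbound (G z).
have GMn n v : rnorm (iter n (G z) v) <= M ^+ n * rnorm v.
  elim: n => [|n IH]; first by rewrite mul1r.
  by rewrite iterS (le_trans (GM _))// exprS -mulrA ler_wpM2l.
exists (M ^+ 4) => [|r]; first exact: exprn_ge0.
pose q (j : 'I_4) := y (z + r%:C * 'i%C ^+ j).
have q4 := four_points z r; 
have -> : 4%:R * rnorm (y z) = rnorm (4%:R *: y z).
  by rewrite rnormZ -(rmorph_nat (real_complex R)) normc_def/= expr0n addr0
    sqrtr_sqr ger0_norm// rmorph_nat.
have -> : 4%:R *: y z =
    \sum_(j < 4) q j - (r ^+ 4)%:C *: iter 4 (G z) (\sum_(j < 4) q j).
  by rewrite [in X in X - _]q4 addrK.
rewrite (le_trans (rnormB _ _))// mulrDl mul1r.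
rewrite rnormZ_real ger0_norm ?exprn_even_ge0// lerD ?rnorm_sum// -mulrA.
rewrite ler_wpM2l ?exprn_even_ge0// (le_trans (GMn _ _))//.
by rewrite ler_wpM2l ?exprn_ge0// rnorm_sum.
Qed.

(** From y w = y z + (w - z) G z (y w): once |w - z| is at most half the inverse
    of a bound of G z, the norm of y w is at most twice that of y z, and the
    difference is then controlled by |w - z|. *)
Lemma resolvent_continuous :
  continuous (fun p : R * R => rnorm (y (p.1 +i* p.2))).
Proof.
move=> [a b]; set z := a +i* b.
have [M M0 GM] := bop_rbound (G z).
apply/cvgrPdist_le => e e0 /=; rewrite -/z.
set N := rnorm (y z).
have N0 : 0 <= N by exact: rnorm_ge0.
pose d := Num.min ((2 * (M + 1))^-1) (e / (2 * (M * N + 1))).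
have MN0 : 0 <= M * N by exact: mulr_ge0.
have d0 : 0 < d.
  by rewrite lt_min invr_gt0 divr_gt0// ?mulr_gt0// ltr_wpDl.
have d20 : 0 < d / 2 by rewrite divr_gt0.
have near1 : \forall p \near (a, b), `|a - p.1| < d / 2.
  apply: (iffLR (cvgrPdist_lt (F := nbhs (a, b)) (fun p : R * R => p.1) a)) => //.
  exact: (@cvg_fst _ _ (nbhs a) (nbhs b) _).
have near2 : \forall p \near (a, b), `|b - p.2| < d / 2.
  apply: (iffLR (cvgrPdist_lt (F := nbhs (a, b)) (fun p : R * R => p.2) b)) => //.
  exact: (@cvg_snd _ _ (nbhs a) (nbhs b) _).
apply: filterS2 near1 near2 => -[a' b'] /= pa pb; set w := a' +i* b'.
set N' := rnorm (y w).
pose c := complex.Re `|w - z|.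
have c0 : 0 <= c by rewrite -ler0c /c RRe_real// normr_real.
have cd : c <= d.
  rewrite /c /z /w (le_trans (cabs_le _ _))// (splitr d) lerD// distrC ltW//.
have N'0 : 0 <= N' by exact: rnorm_ge0.
have H : rnorm (y w - y z) <= c * (M * N').
  by rewrite [X in X - _](resolvent z) addrC addKr rnormZ ler_wpM2l// GM.
have H1 : N' <= N + c * (M * N').
  rewrite -lerBlDl (le_trans _ H)// lerBlDr -[N'](_ : rnorm (y w - y z + y z) = _).
    exact: rnormD.
  by rewrite subrK.
have H2 : N <= N' + c * (M * N').
  rewrite -lerBlDl (le_trans _ H)// lerBlDr -[N](_ : rnorm (- (y w - y z) + y w) = _).
    by rewrite (le_trans (rnormD _ _))// rnormN.
  by rewrite opprB subrK.
have d1 : d * (2 * (M + 1)) <= 1.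
  by rewrite -ler_pdivlMr ?mulr_gt0 ?ltr_wpDl// div1r ge_min lexx.
have d2 : d * (2 * (M * N + 1)) <= e.
  by rewrite -ler_pdivlMr ?mulr_gt0 ?ltr_wpDl// ge_min lexx orbT.
have cdM : c * M <= d * M by exact: ler_wpM2r.
have cM : c * M <= 2^-1 by lra.
have cMN' : c * M * N' <= 2^-1 * N' by exact: ler_wpM2r.
have N2 : N' <= 2 * N by lra.
have cM0 : 0 <= c * M by exact: mulr_ge0.
have cN : c * M * N' <= d * M * (2 * N).
  by apply: (le_trans (ler_wpM2l cM0 N2)); apply: ler_wpM2r cdM; lra.
rewrite ler_norml; apply/andP; split; lra.
Qed.


(** Adding eps |z|^2 makes the norm of y strictly subharmonic: the mean over
    four points at distance t increases by eps t^2, more than the error of order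
    t^4 in the mean value inequality when t is small. *)
Lemma no_interior_max (eps r a b : R) (z := a +i* b) : 0 < eps -> 0 < r ->
  (forall p : R * R, `|p.1 - a| + `|p.2 - b| <= r ->
    rnorm (y (p.1 +i* p.2)) + eps * (p.1 ^+ 2 + p.2 ^+ 2) <=
    rnorm (y z) + eps * (a ^+ 2 + b ^+ 2)) -> False.
Proof.
move=> e0 r0 zmax.
have [M M0 ymean] := rnorm_mean z.
set N := rnorm (y z) in zmax ymean.
have N0 : 0 <= N by exact: rnorm_ge0.
have MN0 : 0 <= M * N by exact: mulr_ge0.
pose t := Num.min r (Num.min 1 (eps / (2 * (M * N + 1)))).
have t0 : 0 < t by rewrite !lt_min r0 ltr01 divr_gt0// mulr_gt0// ltr_wpDl.
have tr : t <= r by rewrite ge_min lexx.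
have t1 : t <= 1 by rewrite !ge_min lexx orbT.
have te : t * (2 * (M * N + 1)) <= eps.
  by rewrite -ler_pdivlMr ?mulr_gt0 ?ltr_wpDl// !ge_min lexx !orbT.
have {ymean} := ymean t.
rewrite !big_ord_recl big_ord0 /= /bump/= !addn0 !add1n addr0.
have -> : z + t%:C * 'i%C ^+ 0 = (a + t) +i* b.
  by rewrite expr0 mulr1 /z; simpc.
have -> : z + t%:C * 'i%C ^+ 1 = a +i* (b + t).
  by rewrite expr1 /z; simpc.
have -> : z + t%:C * 'i%C ^+ 2 = (a - t) +i* b.
  by rewrite sqr_i mulrN1 /z; simpc.
have -> : z + t%:C * 'i%C ^+ 3 = a +i* (b - t).
  by rewrite exprS sqr_i mulrN1 mulrN /z; simpc.
have := zmax (a + t, b); have := zmax (a, b + t).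
have := zmax (a - t, b); have := zmax (a, b - t).
rewrite /= !subrr !normr0 !add0r !addr0 ![_ + t]addrC ![_ - t]addrC !addrK.
rewrite !normrN !(ger0_norm (ltW t0)).
move=> /(_ tr) z1 /(_ tr) z2 /(_ tr) z3 /(_ tr) z4.
set S := (X in _ <= _ * X).
have S4 : S <= 4 * N - 4 * eps * t ^+ 2.
  by rewrite /S; lra.
have t4 : 0 <= t ^+ 4 * M by rewrite mulr_ge0// exprn_even_ge0.
move=> NS; have := le_trans NS (ler_wpM2l (addr_ge0 ler01 t4) S4).
have t2 : 0 < t ^+ 2 by rewrite exprn_gt0.
have -> : (1 + t ^+ 4 * M) * (4 * N - 4 * eps * t ^+ 2) = 4 * N +
  4 * t ^+ 2 * (t ^+ 2 * (M * N) - eps - eps * (t ^+ 4 * M)) by ring.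
rewrite lerDl pmulr_rge0 ?mulr_gt0//.
have : 0 <= eps * (t ^+ 4 * M) by rewrite mulr_ge0// ltW.
have : t ^+ 2 * (M * N) <= t * (M * N).
  by rewrite ler_wpM2r// expr2 -[leRHS]mul1r ler_wpM2r// ltW.
have := mulr_ge0 (ltW t0) MN0.
lra.
Qed.

(** The vector form of the nonemptiness of the spectrum. By the absence of
    interior maxima, the maximum over a square of the norm of y plus eps |z|^2
    is attained on the boundary, where y is small because y z = (U y z - v) / z;
    for a large square and a small eps this contradicts y 0 <> 0. *)
Lemma no_entire_resolvent (U : 'B(E)) (v : E) :
  (forall z, U (y z) - z *: y z = v) -> v = 0.
Proof.
move=> Uy; suff y0 : y 0 = 0 by rewrite -(Uy 0) scale0r subr0 y0 linear0.
apply/eqP; rewrite -rnorm_eq0; apply: contrapT => /negP.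
rewrite neq_lt ltNge rnorm_ge0/=; set eta := rnorm _ => eta0.
have [M M0 UM] := bop_rbound U.
have ybound z : rnorm (y z) * complex.Re `|z| <= M * rnorm (y z) + rnorm v.
  rewrite mulrC -rnormZ (_ : z *: y z = U (y z) - v).
    by rewrite (le_trans (rnormB _ _))// lerD2r.
  by rewrite -(Uy z) opprB addrC subrK.
set N := rnorm v in ybound; have N0 : 0 <= N by exact: rnorm_ge0.
(* Where |z| is at least L the norm of y z is below eta / 3, and eps is such
   that eps |z|^2 is at most eta / 3 on the square. *)
pose L := M + 1 + 3 * N / eta.
have N3 : 0 <= 3 * N / eta by rewrite divr_ge0 ?mulr_ge0 ?(ltW eta0).
have L0 : 0 < L by rewrite /L; lra.
pose eps := eta / (6 * L ^+ 2).
have eps0 : 0 < eps by rewrite divr_gt0 ?mulr_gt0 ?exprn_gt0.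
pose phi (p : R * R) := rnorm (y (p.1 +i* p.2)) + eps * (p.1 ^+ 2 + p.2 ^+ 2).
pose A : set (R * R) := `[- L, L]%classic `*` `[- L, L]%classic.
have LL : - L <= L by lra.
have A00 : A (0, 0) by split; rewrite /= in_itv/=; lra.
have [||[a b] abA phimax] := @compact_EVT_max _ R phi A (ex_intro _ _ A00).
- by apply: compact_setX; exact: segment_compact.
- apply: continuous_subspaceT => p; apply: cvgD.
    exact: resolvent_continuous.
  apply: cvgM; first exact: cvg_cst.
  by apply: cvgD; apply: cvgM; (exact: cvg_fst || exact: cvg_snd).
move: abA; rewrite inE => -[/=]; rewrite !in_itv/= => aL bL.
have [ab|] := leP L (complex.Re `|a +i* b|).
  have := phimax (0, 0); rewrite inE => /(_ A00).
  rewrite /phi/= -[0 +i* 0]/(0 : R[i]) -/eta expr0n addr0 mulr0 addr0.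
  have := ybound (a +i* b); set c := complex.Re _ in ab *.
  set n := rnorm (y (a +i* b)); have n0 : 0 <= n by exact: rnorm_ge0.
  have nc : n * L <= n * c by rewrite ler_wpM2l.
  have nL : n * L = n * M + n + n * (3 * N / eta) by rewrite /L; ring.
  have e2 : eps * (a ^+ 2 + b ^+ 2) <= eta / 3.
    have -> : eta / 3 = eps * (L ^+ 2 + L ^+ 2).
      by rewrite /eps; field; rewrite gt_eqF.
    rewrite ler_wpM2l ?(ltW eps0)//.
    have sqrL x : - L <= x <= L -> x ^+ 2 <= L ^+ 2.
      rewrite -ler_norml => xL; rewrite -(real_normK (num_real x)).
      by rewrite lerXn2r ?nnegrE ?normr_ge0 ?(ltW L0).
    exact: lerD (sqrL a aL) (sqrL b bL).
  move=> nN en.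
  have H : n + n * (3 * N / eta) <= N by lra.
  have H' : n * eta + n * (3 * N) <= N * eta.
    have := ler_wpM2r (ltW eta0) H.
    by rewrite mulrDl -[n * _ * eta]mulrA divfK ?gt_eqF.
  nra.
move=> abL; have [ac bc] := cabs_ge a b.
pose r := Num.min (L - `|a|) (L - `|b|).
apply: (@no_interior_max eps r a b) => //.
  by rewrite lt_min !subr_gt0 (le_lt_trans ac)// (le_lt_trans bc).
move=> [a' b'] /= ab'; suff Aab : A (a', b').
  exact: (phimax (a', b') (mem_set Aab)).
split=> /=; rewrite in_itv/= -ler_norml.
  have : `|a' - a| <= L - `|a|.
    apply: le_trans (_ : r <= _); last by rewrite ge_min lexx.
    by rewrite (le_trans _ ab')// lerDl.
  by rewrite lerBrDr; apply: le_trans; rewrite -{1}(subrK a a') ler_normD.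
have : `|b' - b| <= L - `|b|.
  apply: le_trans (_ : r <= _); last by rewrite ge_min lexx orbT.
  by rewrite (le_trans _ ab')// lerDr.
by rewrite lerBrDr; apply: le_trans; rewrite -{1}(subrK b b') ler_normD.
Qed.

End LocalSpectrum.

(** * The ideal of null sets of a representation *)

Section NullSets.
Variables (R : realType) (X : Type) (K : X -> finDimBanachType R[i]).
Variables (E : completeNormedModType R[i]) (pi : representation K E).
Implicit Types (c : X -> R[i]) (A : set X).

Definition scal c : op_prod K := fun x => c x *: (1 : 'B(K x)).

Definition ind A : X -> R[i] := fun x => (x \in A)%:R.

(** The values of a function c on a null set have no influence on pi (scal c)
    ([eq_off_null]), so that c acts as if it were defined up to null sets. *)
Definition null A := pi (scal (ind A)) = 0.

Lemma scalD c c' : scal (fun x => c x + c' x) = scal c + scal c'.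
Proof. by apply/functional_extensionality_dep => x; exact: scalerDl. Qed.

Lemma scalZ a c : scal (fun x => a * c x) = a *: scal c.
Proof.
by apply/functional_extensionality_dep => x; rewrite /scal -scalerA.
Qed.

Lemma scalM c c' : scal (fun x => c x * c' x) = scal c * scal c'.
Proof.
apply/functional_extensionality_dep => x; apply: bop_ext => v.
by rewrite /scal/= scalerA.
Qed.

Lemma repM b b' v : pi (b * b') v = pi b (pi b' v).
Proof. by have [_ ->] := rep_morph pi. Qed.

Lemma rep_scalM c c' v :
  pi (scal (fun x => c x * c' x)) v = pi (scal c) (pi (scal c') v).
Proof. by rewrite scalM repM. Qed.

Lemma rep_scal1 : pi (scal (fun=> 1)) = 1.
Proof.
have [<- _] := rep_morph pi; congr (pi _).
by apply/functional_extensionality_dep => x; rewrite /scal scale1r.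
Qed.

Lemma ind_in A x : A x -> ind A x = 1.
Proof. by move=> Ax; rewrite /ind mem_set. Qed.

Lemma ind_out A x : ~ A x -> ind A x = 0.
Proof. by move=> Ax; rewrite /ind memNset. Qed.

Lemma eq_off_null A c c' : null A -> (forall x, ~ A x -> c x = c' x) ->
  pi (scal c) = pi (scal c').
Proof.
move=> NA cc'.
have -> : c = (fun x => c' x + (c x - c' x) * ind A x).
  apply/funext => x; have [Ax|Ax] := pselect (A x).
    by rewrite ind_in// mulr1 addrC subrK.
  by rewrite ind_out// mulr0 addr0 cc'.
apply: bop_ext => v.
by rewrite scalD linearD [LHS]/= rep_scalM NA linear0 addr0.
Qed.

Lemma null0 : null set0.
Proof.
rewrite /null (_ : scal _ = 0) ?linear0//.
by apply/functional_extensionality_dep => x; rewrite /scal ind_out// scale0r.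
Qed.

Lemma null_sub A A' : A `<=` A' -> null A' -> null A.
Proof.
move=> AA' NA'; rewrite /null (eq_off_null (c' := ind set0) NA') ?null0//.
by move=> x Ax; rewrite !ind_out// => /AA'.
Qed.

Lemma nullU A A' : null A -> null A' -> null (A `|` A').
Proof.
move=> NA NA'; rewrite /null -NA' /null; apply: (eq_off_null NA) => x Ax.
by rewrite /ind in_setU (memNset Ax).
Qed.

(** Otherwise the function equal to n on A n would act with eigenvalue n on the
    range of the idempotent of A n, for every n. *)
Lemma null_ccc (A : nat -> set X) : trivIset setT A -> exists n, null (A n).
Proof.
move=> tA; apply: contrapT => /forallNP NA.
pose c x : R[i] := (xget 0%N [set n | A n x])%:R.
have cE n x : A n x -> c x = n%:R.
  move=> An; rewrite /c; case: xgetP => [m _ Am|/(_ n)//].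
  by congr (_%:R); apply: (tA m n) => //; exists x.
have [M M0 cM] := bop_rbound (pi (scal c)).
pose n := Num.bound M; apply: (NA n); apply: bop_ext => v /=.
set w := pi _ v; apply/eqP; rewrite -rnorm_eq0; apply: contrapT => /negP w0.
have wE : pi (scal c) w = n%:R *: w.
  rewrite /w -rep_scalM -[RHS]/((n%:R *: pi (scal (ind (A n)))) v) -linearZ -scalZ.
  congr (pi (scal _) v); apply/funext => x.
  have [Ax|Ax] := pselect (A n x); first by rewrite (cE n).
  by rewrite ind_out// !mulr0.
have := cM w; rewrite wE -(rmorph_nat (real_complex R)) rnormZ_real normr_nat.
rewrite ler_pM2r ?lt_neqAle ?rnorm_ge0 1?eq_sym ?w0//.
by rewrite leNgt (archi_boundP M0).
Qed.

(** Otherwise u - z would be invertible modulo null sets for every z, its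
    inverse on A being 1 / (u - z); where u = z this quotient is 0, on a null
    set. *)
Lemma null_sigma A (u : X -> nat) :
  (forall n, null (A `&` u @^-1` [set n])) -> null A.
Proof.
move=> Nu; pose U x : R[i] := (u x)%:R.
have NU z : null (A `&` [set x | U x = z]).
  have [[n zn]|nz] := pselect (exists n, z = n%:R).
    apply: null_sub (Nu n) => x [Ax /=]; rewrite zn => Uz; split=> //=.
    by apply/eqP; rewrite -(eqr_nat R[i]); exact/eqP.
  by apply: null_sub null0 => x [_ /= Uz]; apply: nz; exists (u x).
pose g z x := ind A x / (U x - z).
apply: bop_ext => v.
apply: (@no_entire_resolvent _ _ (fun z => pi (scal (g z)))
  (fun z => pi (scal (g z)) v) _ (pi (scal U))) => [z w|z].
  rewrite -rep_scalM -[_ *: pi _ v]/((_ *: pi _) v) -linearZ -scalZ.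
  rewrite -[RHS]/((pi _ + pi _) v) -linearD -scalD.
  congr (bop_fun _ v); apply: (eq_off_null (nullU (NU z) (NU w))) => x.
  move=> /not_orP[Az Aw]; rewrite /g.
  have [Ax|Ax] := pselect (A x); last by rewrite ind_out// !(mulr0, mul0r) addr0.
  rewrite ind_in//.
  have Uz : U x - z != 0 by rewrite subr_eq0; apply/eqP => Ux; apply: Az.
  have Uw : U x - w != 0 by rewrite subr_eq0; apply/eqP => Ux; apply: Aw.
  by field; rewrite Uz Uw.
have -> : pi (scal (ind A)) = pi (scal (fun x => (U x + - z * 1) * g z x)).
  apply: (eq_off_null (NU z)) => x Az; rewrite /g.
  have [Ax|Ax] := pselect (A x); last by rewrite ind_out// !(mulr0, mul0r).
  rewrite ind_in//.
  have Uz : U x - z != 0 by rewrite subr_eq0; apply/eqP => Ux; apply: Az.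
  by field.
by rewrite rep_scalM scalD linearD scalZ [in RHS]linearZ rep_scal1 /= scaleNr.
Qed.

Lemma null_cofinite : less_than_measurable X ->
  finite_set [set x | ~ null [set x]] /\ null [set x | null [set x]].
Proof.
apply: sigma_ideal_finite.
- exact: null0.
- exact: null_sub.
- exact: nullU.
- exact: null_ccc.
- exact: null_sigma.
Qed.

End NullSets.

(** * Boundedness of coordinates on finite dimensional spaces *)

Lemma le_mx_norm (R : realType) n (x : 'rV[R]_n) j : `|x ord0 j| <= `|x|.
Proof.
rewrite [leRHS]/Num.norm /= mx_normrE; apply/bigmax_geP; right => /=.
by exists (ord0, j).
Qed.

Section CoordBounded.
Local Open Scope complex_scope.
Local Open Scope ring_scope.
Variables (R : realType) (K : finDimBanachType R[i]).
Local Notation n := (\dim {:K}).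
Local Notation e := (vbasis {:K}).

(* The linear bijection from R^2n; real coordinates are used because bounded
   closed sets of real row vectors are compact. *)
Let g (x : 'rV[R]_(n + n)) : K :=
  \sum_(i < n) (x ord0 (lshift n i) +i* x ord0 (rshift n i)) *: e`_i.

Let gB x x' : g (x - x') = g x - g x'.
Proof.
rewrite /g -sumrB; apply: eq_bigr => i _; rewrite -scalerBl !mxE.
by congr (_ *: _); simpc.
Qed.

Let gZ (a : R) x : g (a *: x) = a%:C *: g x.
Proof.
rewrite /g scaler_sumr; apply: eq_bigr => i _; rewrite scalerA !mxE.
by congr (_ *: _); simpc.
Qed.

Let g_bounded : exists2 C : R, 0 <= C & forall x, rnorm (g x) <= C * `|x|.
Proof.
exists (\sum_(i < n) 2 * rnorm e`_i).
  by apply: sumr_ge0 => i _; rewrite mulr_ge0// rnorm_ge0.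
move=> x; rewrite (le_trans (rnorm_sum _))// mulr_suml ler_sum// => i _.
rewrite rnormZ mulrAC ler_wpM2r ?rnorm_ge0// (le_trans (cabs_le _ _))//.
by rewrite mulr_natl mulr2n lerD// le_mx_norm.
Qed.

Let g_continuous : continuous (fun x => rnorm (g x)).
Proof.
have [C C0 gC] := g_bounded; move=> x.
apply/(@cvgrPdist_le _ _ _ _ (nbhs_filter x)) => d d0.
have C1 : 0 < C + 1 by rewrite ltr_wpDl.
have dC : 0 < d / (C + 1) by rewrite divr_gt0.
have := nbhsx_ballx x _ dC; rewrite -ball_normE.
apply: (@filterS _ _ (nbhs_filter x)) => x' /ltW xx'.
have H : rnorm (g x - g x') <= d.
  rewrite -gB (le_trans (gC _))// (le_trans (ler_wpM2l C0 xx'))//.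
  by rewrite mulrA ler_pdivrMr// mulrC ler_wpM2l ?(ltW d0)// lerDl.
have H1 : rnorm (g x) <= rnorm (g x') + rnorm (g x - g x').
  by rewrite -{1}(subrK (g x') (g x)) addrC rnormD.
have H2 : rnorm (g x') <= rnorm (g x) + rnorm (g x - g x').
  by rewrite -(rnormN (g x - _)) opprB -{1}(subrK (g x) (g x')) addrC rnormD.
by rewrite ler_norml; apply/andP; split; lra.
Qed.

Let g_free x : g x = 0 -> x = 0.
Proof.
move=> gx0; have /freeP/(_ _ gx0) x0 := basis_free (vbasisP {:K}).
apply/rowP => j; rewrite mxE; have [i ->|i ->] := split_ordP j;
  by have /eqP := x0 i; rewrite eq_complex/= => /andP[/eqP ? /eqP ?].
Qed.

(** The norm of g is continuous and does not vanish on the compact unit sphere,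
    hence is bounded below there. *)
Lemma coord_bounded (i : 'I_n) :
  exists M : R[i], forall u : K, `|coord e i u| <= M * `|u|.
Proof.
pose S := [set x : 'rV[R]_(n + n) | `|x| = 1].
have normS x : x != 0 -> S (`|x|^-1 *: x).
  by move=> x0; rewrite /S/= normrZ normfV normr_id mulVf// normr_eq0.
have S0 : S !=set0.
  exists (`|const_mx 1 : 'rV[R]_(n + n)|^-1 *: const_mx 1); apply: normS.
  apply/eqP => /rowP/(_ (lshift n i)); rewrite !mxE; exact/eqP/oner_neq0.
have Sc : compact S.
  apply: bounded_closed_compact.
    by exists 1; split => // M M1 x /= ->; exact: ltW.
  apply: (@closed_comp _ _ (fun x : 'rV[R]_(n + n) => `|x|) [set 1]).
    by move=> x _; exact: norm_continuous.
  exact: closed_eq.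
have [|x0 x0S x0min] := EVT_min_rV S0 Sc (f := fun x => rnorm (g x)).
  exact: continuous_subspaceT g_continuous.
set c := rnorm (g x0) in x0min.
have c0 : 0 < c.
  rewrite lt_neqAle rnorm_ge0 andbT eq_sym rnorm_eq0; apply/eqP => /g_free x00.
  by move: x0S; rewrite inE /S/= x00 normr0 => /eqP; rewrite eq_sym oner_eq0.
have gc x : c * `|x| <= rnorm (g x).
  have [->|xn0] := eqVneq x 0; first by rewrite normr0 mulr0 rnorm_ge0.
  have := x0min _ (mem_set (normS x xn0)); rewrite gZ rnormZ_real normfV normr_id.
  by rewrite ler_pdivlMl ?normr_gt0// mulrC.
exists (2 / c)%:C => u.
pose x : 'rV[R]_(n + n) := row_mx (\row_i complex.Re (coord e i u))
  (\row_i complex.Im (coord e i u)).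
have gx : g x = u.
  rewrite /g [RHS](coord_vbasis (memvf u)); apply: eq_bigr => j _.
  rewrite row_mxEl row_mxEr !mxE; congr (_ *: _).
  by case: (coord e j u).
have xi : coord e i u = x ord0 (lshift n i) +i* x ord0 (rshift n i).
  by rewrite row_mxEl row_mxEr !mxE; case: (coord e i u).
rewrite (rnormE u) -rmorphM/= -[leLHS]RRe_real ?normr_real// lecR xi -gx.
rewrite (le_trans (cabs_le _ _))// -mulrA (le_trans (_ : _ <= 2 * `|x|))//.
  by rewrite mulr_natl mulr2n lerD// le_mx_norm.
by rewrite ler_wpM2l// ler_pdivlMl.
Qed.

End CoordBounded.

(** * The range of an idempotent as a Banach space *)

Lemma bop_continuous (k : numFieldType) (V W : normedModType k)
  (f : bounded_op V W) : continuous f.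
Proof.
have [M M0 fM] := bop_bound_ge0 f.
move=> x; apply/cvgrPdist_le => d d0.
have M1 : 0 < M + 1 by rewrite ltr_wpDl.
have dM : 0 < d / (M + 1) by rewrite divr_gt0.
near=> x'; have xx' : `|x - x'| <= d / (M + 1) by near: x'; exact: cvgr_dist_le.
rewrite -linearB (le_trans (fM _))// (le_trans (ler_wpM2l M0 xx'))//.
by rewrite mulrA ler_pdivrMr// mulrC ler_wpM2l ?(ltW d0)// lerDl.
Unshelve. all: by end_near. Qed.

Section FixedSpace.
Variables (k : numFieldType) (E : completeNormedModType k) (P : 'B(E)).

(** Describing the range of an idempotent P as the kernel of P - 1 makes it
    visibly a closed subspace. *)
Definition fixed_pred : {pred E} := [pred v | P v == v].

Fact fixed_submod_closed : submod_closed fixed_pred.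
Proof.
split=> [|a u v]; rewrite !inE ?linear0// => /eqP Pu /eqP Pv.
by rewrite linearP /= Pu Pv.
Qed.
HB.instance Definition _ :=
  GRing.isSubmodClosed.Build k E fixed_pred fixed_submod_closed.

Definition fixed_space : Type := {v : E | v \in fixed_pred}.
HB.instance Definition _ := [isSub of fixed_space for @sval E _].
HB.instance Definition _ := [Choice of fixed_space by <:].
HB.instance Definition _ := [SubChoice_isSubLmodule of fixed_space by <:].

Let norm (v : fixed_space) : k := `|val v|.

Let normD v w : norm (v + w) <= norm v + norm w.
Proof. exact: ler_normD. Qed.
Let normZ a v : norm (a *: v) = `|a| * norm v.
Proof. exact: normrZ. Qed.
Let norm_eq0 v : norm v = 0 -> v = 0.
Proof. by move=> /normr0_eq0 v0; exact: val_inj. Qed.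

HB.instance Definition _ :=
  Lmodule_isNormed.Build k fixed_space normD normZ norm_eq0.

Lemma fixed_complete (F : set_system fixed_space) :
  ProperFilter F -> cauchy F -> cvg F.
Proof.
move=> FF /cauchyP Fc.
have cF : cvg ((val : fixed_space -> E) @ F).
  apply: cauchy_cvg; apply/cauchyP => e e0; have [x Fx] := Fc e e0.
  exists (val x); suff : F (val @^-1` ball (val x) e) by [].
  by apply: filterS Fx => w /=; rewrite -!ball_normE.
set l := lim ((val : fixed_space -> E) @ F) in cF.
have Pl : P l == l.
  apply/eqP; have PF : P (val v) @[v --> F] --> P l.
    by apply: continuous_cvg cF; exact: bop_continuous.
  apply: (cvg_unique _ PF) => //; rewrite (_ : (fun v => P (val v)) = val)//.
  by apply/funext => v; apply/eqP; exact: (valP v).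
apply/cvg_ex; exists (exist _ l Pl : fixed_space).
apply/(@cvgrPdist_lt _ _ _ F FF id) => e e0.
by have /cvgrPdist_lt/(_ _ e0) := cF.
Qed.

HB.instance Definition _ := Uniform_isComplete.Build fixed_space fixed_complete.

Definition fixed_incl : bounded_op fixed_space E.
Proof.
refine (@BoundedOp k fixed_space E val _ _); first by move=> a x y; exact: linearP.
by exists 1 => x; rewrite mul1r.
Defined.

Hypothesis PP : forall v, P (P v) = P v.

Fact fixed_image v : P v \in fixed_pred.
Proof. by rewrite inE PP. Qed.

Definition fixed_proj : bounded_op E fixed_space.
Proof.
refine (@BoundedOp k E fixed_space (fun v => exist _ (P v) (fixed_image v)) _ _).
  by move=> a x y; apply: val_inj; exact: linearP.
by have [M fM] := bop_bounded P; exists M.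
Defined.

Lemma fixed_projE v : val (fixed_proj v) = P v.
Proof. by []. Qed.

End FixedSpace.

(** * Matrix units and the decomposition *)

Section BopCombinators.
Variable k : numFieldType.

Definition bop_then (U V W : normedModType k) (f : bounded_op U V)
  (g : bounded_op V W) : bounded_op U W.
Proof.
refine (@BoundedOp k U W (fun x => g (f x)) _ _).
  by move=> a x y; rewrite !linearP.
have [M M0 gM] := bop_bound_ge0 g; have [N _ fN] := bop_bound_ge0 f.
by exists (M * N) => x; rewrite (le_trans (gM _))// -mulrA ler_wpM2l.
Defined.

Lemma bop_sumE (V W : normedModType k) (J : Type) (r : seq J)
  (f : J -> bounded_op V W) v : (\sum_(i <- r) f i) v = \sum_(i <- r) f i v.
Proof. by elim: r => [|i r IH]; rewrite ?big_nil// !big_cons -IH. Qed.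

Variables (I : finType) (E : I -> completeNormedModType k) (V : normedModType k).

Definition dsum_into (f : forall i, bounded_op V (E i)) : bounded_op V (dsum E).
Proof.
refine (@BoundedOp k V (dsum E) (fun v i => f i v) _ _).
  by move=> a x y; apply/functional_extensionality_dep => i; rewrite linearP.
pose M i := s2val (cid2 (bop_bound_ge0 (f i))).
have fM i x : `|f i x| <= M i * `|x| by rewrite /M; case: cid2.
exists (\sum_i M i) => x; rewrite dsum_normE mulr_suml ler_sum// => i _.
exact: fM.
Defined.

Definition dsum_outof (f : forall i, bounded_op (E i) V) :
  bounded_op (dsum E) V.
Proof.
refine (@BoundedOp k (dsum E) V (fun w => \sum_i f i (w i)) _ _).
  move=> a x y; rewrite scaler_sumr -big_split/=; apply: eq_bigr => i _.
  exact: linearP.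
pose M i := s2val (cid2 (bop_bound_ge0 (f i))).
have M0 i : 0 <= M i by rewrite /M; case: cid2.
have fM i x : `|f i x| <= M i * `|x| by rewrite /M; case: cid2.
exists (\sum_i M i) => w; rewrite (le_trans (ler_norm_sum _ _ _))//.
rewrite mulr_suml ler_sum// => i _; rewrite (le_trans (fM i _))//.
exact: ler_wpM2l (dsum_norm_ge w i).
Defined.

End BopCombinators.

Section MatrixUnits.
Variables (R : realType) (K : finDimBanachType R[i]).
Local Notation n := (\dim {:K}).
Local Notation e := (vbasis {:K}).

Definition munit (i j : 'I_n) : 'B(K).
Proof.
refine (@BoundedOp R[i] K K (fun u => coord e j u *: e`_i) _ _).
  by move=> a u v; rewrite linearP/= scalerDl scalerA.
have [M jM] := coord_bounded j; exists (M * `|e`_i|) => u.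
by rewrite normrZ mulrAC ler_wpM2r.
Defined.

Lemma coord_basis (i j : 'I_n) : coord e j e`_i = (i == j)%:R.
Proof. by rewrite coord_free ?(basis_free (vbasisP _))// eq_sym. Qed.

Lemma munitM i j l m : munit i j * munit l m = (l == j)%:R *: munit i m.
Proof.
apply: bop_ext => u /=; rewrite linearZ /= coord_basis.
by rewrite !scalerA mulrC.
Qed.

Lemma sum_munit : \sum_i munit i i = 1.
Proof.
apply: bop_ext => u; rewrite [RHS](coord_vbasis (memvf u)).
exact: bop_sumE.
Qed.

(** Row j of the matrix of a, read off in the algebra itself: this is what
    turns the intertwining property into the definition of tensor_op. *)
Lemma munit_mull i j (a : 'B(K)) :
  munit i j * a = \sum_(l < n) coord e j (a e`_l) *: munit i l.
Proof.
apply: bop_ext => u; rewrite bop_sumE /=.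
under [RHS]eq_bigr do rewrite scalerA.
rewrite -scaler_suml [in LHS](coord_vbasis (memvf u)) !linear_sum/=.
by congr (_ *: _); apply: eq_bigr => l _; rewrite !linearZ mulrC.
Qed.

End MatrixUnits.

Section Factors.
Variables (R : realType) (X : choiceType) (K : X -> finDimBanachType R[i]).

(** The nonunital embedding of the factor B(K_x) in the product. *)
Definition single x (a : 'B(K x)) : op_prod K :=
  @eqtype.dfwith X (fun x => 'B(K x)) (0 : op_prod K) x a.

Lemma single_in x (a : 'B(K x)) : single a x = a.
Proof. exact: eqtype.dfwith_in. Qed.

Lemma single_out x (a : 'B(K x)) y : x != y -> single a y = 0.
Proof. by move=> xy; rewrite /single eqtype.dfwith_out. Qed.

Lemma op_prodP x (b c : op_prod K) :
  b x = c x -> (forall y, x != y -> b y = c y) -> b = c.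
Proof.
move=> bc bc'; apply/functional_extensionality_dep => y.
by have [<-//|] := eqVneq x y; exact: bc'.
Qed.

Lemma single_linear x : linear (@single x).
Proof.
move=> c a a'; apply: (@op_prodP x) => [|y xy].
  by rewrite [RHS]/(c *: single a x + single a' x) !single_in.
by rewrite [RHS]/(c *: single a y + single a' y) !single_out// scaler0; exact/esym/addr0.
Qed.

Lemma single_mulr x (a : 'B(K x)) (b : op_prod K) :
  single a * b = single (a * b x).
Proof.
apply: (@op_prodP x) => [|y xy].
  by rewrite [LHS]/(single a x * b x) !single_in.
by rewrite [LHS]/(single a y * b y) !single_out//; exact: mul0r.
Qed.

Lemma single_ind x : single (1 : 'B(K x)) = scal K (ind R [set x]).
Proof.
apply: (@op_prodP x) => [|y xy].
  by rewrite single_in /scal ind_in// scale1r.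
by rewrite single_out// /scal ind_out ?scale0r// => yx; rewrite yx eqxx in xy.
Qed.

End Factors.

Lemma munit_index (R : realType) (V : finDimBanachType R[i]) :
  (1 : 'B(V)) <> 0 -> (0 < \dim {:V})%N.
Proof.
move=> V10; rewrite lt0n dimv_eq0; apply/eqP => V0; apply: V10.
by apply: bop_ext => u /=; apply/eqP; rewrite -memv0 -V0 memvf.
Qed.

Section Corner.
Variables (R : realType) (X : choiceType) (K : X -> finDimBanachType R[i]).
Variables (E : completeNormedModType R[i]) (pi : representation K E).

Definition rep_at x (a : 'B(K x)) : 'B(E) := pi (single a).

Lemma rep_at_linear x : linear (@rep_at x).
Proof. by move=> c a a'; rewrite /rep_at single_linear linearP. Qed.

HB.instance Definition _ x :=
  GRing.isLinear.Build R[i] 'B(K x) 'B(E) *:%R (@rep_at x) (@rep_at_linear x).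

Lemma rep_at_rep x (a : 'B(K x)) b v : rep_at a (pi b v) = rep_at (a * b x) v.
Proof. by rewrite /rep_at -single_mulr repM. Qed.

Lemma rep_atM x (a a' : 'B(K x)) v : rep_at a (rep_at a' v) = rep_at (a * a') v.
Proof. by rewrite rep_at_rep single_in. Qed.

Lemma rep_at_orth x y (a : 'B(K x)) (a' : 'B(K y)) v :
  y != x -> rep_at a (rep_at a' v) = 0.
Proof.
move=> yx; rewrite rep_at_rep single_out//.
by rewrite (_ : a * 0 = 0) ?linear0//; exact: mulr0.
Qed.

Variable Y : {fset X}.
Hypothesis Ynull : null pi [set x | x \notin Y].

(** The units of the factors at the points of Y sum to the idempotent of Y, which
    agrees with 1 off a null set. *)
Lemma sum_rep_at1 v : \sum_(y : Y) rep_at (1 : 'B(K (val y))) v = v.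
Proof.
under eq_bigr do rewrite /rep_at single_ind.
pose c x : R[i] := \sum_(y : Y) ind R [set val y] x.
have -> : \sum_(y : Y) pi (scal K (ind R [set val y])) v = pi (scal K c) v.
  rewrite -bop_sumE -linear_sum; congr (pi _ v).
  apply/functional_extensionality_dep => x; rewrite /scal /c scaler_suml.
  by elim/big_ind2 : _ => // b b' d d' <- <-.
have -> : pi (scal K c) = pi (scal K (fun=> 1)).
  apply: (eq_off_null Ynull) => x /negP/negPn xY.
  rewrite /c (bigD1 [` xY]%fset)//= ind_in// big1 ?addr0// => y yx.
  by rewrite ind_out// => xy; case/eqP: yx; exact: val_inj.
by rewrite rep_scal1.
Qed.

Hypothesis Ynn : forall y : Y, ~ null pi [set val y].

(** If K y were the zero space, 1 would be 0 in B(K y) and [set y] null. *)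
Lemma dim_gt0 (y : Y) : (0 < \dim {:K (val y)})%N.
Proof.
apply: munit_index => y10; apply: (Ynn (y := y)); rewrite /null -single_ind y10.
exact: (linear0 (@rep_at (val y))).
Qed.

Definition idx0 (y : Y) : 'I_(\dim {:K (val y)}) := Ordinal (dim_gt0 y).

(** The idempotent e_00 of the factor at y, acting on E; its range is the
    multiplicity space K(y). *)
Definition corner (y : Y) : 'B(E) := rep_at (munit (idx0 y) (idx0 y)).

Lemma corner_idem (y : Y) v : corner y (corner y v) = corner y v.
Proof. by rewrite rep_atM munitM eqxx scale1r. Qed.

Definition multiplicity (y : Y) : completeNormedModType R[i] :=
  fixed_space (corner y).

Local Notation target :=
  (dsum (fun y : Y => tensor (K (val y)) (multiplicity y))).

(** Basis vector e_i of K_y carries the component e_0i v, because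
    e_i0 e_0i = e_ii and these sum to the identity. *)
Definition to_sum : bounded_op E target :=
  dsum_into (fun y : Y => dsum_into (fun i : 'I_(\dim {:K (val y)}) =>
    bop_then (rep_at (munit (idx0 y) i)) (fixed_proj (corner_idem y)))).

Definition of_sum : bounded_op target E :=
  dsum_outof (fun y : Y => dsum_outof (fun i : 'I_(\dim {:K (val y)}) =>
    bop_then (fixed_incl (corner y)) (rep_at (munit i (idx0 y))))).

Lemma to_sumE v (y : Y) i :
  val (to_sum v y i : multiplicity y) = rep_at (munit (idx0 y) i) v.
Proof.
transitivity (corner y (rep_at (munit (idx0 y) i) v)); first exact: fixed_projE.
by rewrite rep_atM munitM eqxx scale1r.
Qed.

Lemma of_sumE w :
  of_sum w = \sum_(y : Y) \sum_i rep_at (munit i (idx0 y)) (val (w y i)).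
Proof. by []. Qed.

Lemma to_sumK : cancel to_sum of_sum.
Proof.
move=> v; rewrite of_sumE -[RHS]sum_rep_at1; apply: eq_bigr => y _.
rewrite -sum_munit linear_sum bop_sumE; apply: eq_bigr => i _.
by rewrite to_sumE rep_atM munitM eqxx scale1r.
Qed.

Lemma of_sumK : cancel of_sum to_sum.
Proof.
move=> w; apply/functional_extensionality_dep => y.
apply/functional_extensionality_dep => j; apply: val_inj; rewrite to_sumE of_sumE.
rewrite linear_sum (bigD1 y)//= [X in _ + X]big1 => [|z zy].
  rewrite addr0 linear_sum (bigD1 j)//= big1 => [|i ij].
    rewrite addr0 rep_atM munitM eqxx scale1r; apply/eqP; exact: (valP (w y j)).
  by rewrite rep_atM munitM (negPf ij) scale0r linear0.
rewrite linear_sum big1// => i _; apply: rep_at_orth.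
by apply: contra zy => /eqP/val_inj ->.
Qed.

Lemma to_sum_rep b v : to_sum (pi b v) = p_kappa K multiplicity b (to_sum v).
Proof.
apply/functional_extensionality_dep => y.
apply/functional_extensionality_dep => j; apply: val_inj; rewrite to_sumE.
rewrite rep_at_rep munit_mull linear_sum bop_sumE.
have -> : p_kappa K multiplicity b (to_sum v) y j =
    \sum_(i < \dim {:K (val y)}) coord (vbasis {:K (val y)}) j
      (b (val y) (vbasis {:K (val y)})`_i) *: (to_sum v y i : multiplicity y).
  transitivity ((\sum_(i < \dim {:K (val y)})
    tens (b (val y) (vbasis {:K (val y)})`_i)
      (to_sum v y i : multiplicity y)) j); first by [].
  by rewrite dsum_sumE.
rewrite raddf_sum; apply: eq_bigr => i _.
rewrite [RHS]linearZ linearZ.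
exact: (congr1 (GRing.scale _) (esym (to_sumE v i))).
Qed.

End Corner.

Theorem theorem3p3 (R : realType) (X : choiceType)
    (K : X -> finDimBanachType R[i]) (E : completeNormedModType R[i])
    (pi : representation K E) :
  less_than_measurable X ->
  exists (Y : {fset X}) (kappa : Y -> completeNormedModType R[i]),
    rep_equivalent pi (p_kappa K kappa).
Proof.
move=> /(null_cofinite pi)[Yfin Ynull].
pose Y := fset_set [set x | ~ null pi [set x]].
have YP x : x \in Y <-> ~ null pi [set x] by rewrite in_fset_set// inE.
have Yc : null pi [set x | x \notin Y].
  apply: null_sub Ynull => x /=/negP xY; apply: contrapT => Nx; apply: xY.
  exact/YP.
have Ynn (y : Y) : ~ null pi [set val y] by apply/YP; exact: valP.
exists Y, (multiplicity Ynn), (to_sum Ynn), (of_sum Ynn); split.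
- exact: to_sumK.
- exact: of_sumK.
- exact: to_sum_rep.
Qed.
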